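(* Let $C(\alpha) = C(\alpha_1,\ldots,\alpha_d)$ be a caterpillar. If $C(\alpha)$ is $e$-positive, then \[ \sum_{i=1}^d \binom{\alpha_i}{2} + \sum_{i=1}^d \alpha_i \sum_{\substack{1\le j\le d\\ j \neq i}} |j-i| + \sum_{1 \le i < j \le d} \bigl(\alpha_i\alpha_j(j-i+1) + j-i-1\bigr) \ \ge\ \sum_{k = \lceil \frac{|\alpha|+d}{2} \rceil}^{|\alpha|+d-2} k(|\alpha|+d-k) + \frac{(|\alpha|-d)(|\alpha|+d-1)}{2}, \] where $|\alpha| = \alpha_1 + \cdots + \alpha_d$.
   Context: Chromatic symmetric function: for a graph $G$ with vertices $v_1,\dots,v_n$, $X_G=\sum_\kappa x_{\kappa(v_1)}\cdots x_{\kappa(v_n)}$, the sum over all proper colorings $\kappa:V(G)\to\{1,2,\dots\}$. For a partition $\lambda=(\lambda_1,\dots,\lambda_\ell)$, $e_\lambda=e_{\lambda_1}\cdots e_{\lambda_\ell}$ with $e_k=\sum_{j_1<\cdots<j_k}x_{j_1}\cdots x_{j_k}$. A graph $G$ is $e$-positive if all coefficients of $X_G$ in the basis $\{e_\lambda\}$ are non-negative. A tree $T$ is a caterpillar if removing all leaves (degree-$1$ vertices) of $T$ yields a path $P$ (with at least one vertex), called the spine of $T$. If $P$ has $d$ vertices $v_1,\dots,v_d$ arranged in order along the path, and $\alpha_i\ge 0$ is the number of leaves of $T$ adjacent to $v_i$, then the caterpillar is denoted $C(\alpha)=C(\alpha_1,\dots,\alpha_d)$. It has $|\alpha|+d$ vertices.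 An empty sum is $0$. *)

(* Defs.v *)
From mathcomp Require Import all_boot all_order all_algebra.
From mathcomp Require Import finmap mpoly.

Set Implicit Arguments.
Unset Strict Implicit.
Unset Printing Implicit Defensive.

Import Order.TTheory GRing.Theory Num.Theory.
Local Open Scope ring_scope.

Record sgraph := SGraph {
  vertex :> finType;
  adj : rel vertex;
  adj_sym : ssrbool.symmetric adj;
  adj_irrefl : irreflexive adj
}.

Definition neighbors (G : sgraph) (x : G) : {set G} := [set y | adj x y].

Definition leaf (G : sgraph) (x : G) : bool := #|neighbors x| == 1%N.

Definition connected (G : sgraph) : Prop := forall x y : G, connect (@adj G) x y.

(* The size condition excludes the closed walks [:: x; y] along one edge. *)
Definition acyclic (G : sgraph) : Prop :=
  forall c : seq G, (2 < size c)%N -> ~ ucycle (@adj G) c.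

Definition tree (G : sgraph) : Prop :=
  [/\ (0 < #|G|)%N, connected G & acyclic G].

(* v enumerates the vertices that remain after deletion of the leaves of G,
   and the subgraph they induce is the path v_0 - v_1 - ... - v_(d-1). *)
Definition spine (G : sgraph) (d : nat) (v : 'I_d -> G) : Prop :=
  [/\ (0 < d)%N,
      injective v,
      forall x : G, ~~ leaf x <-> exists i, x = v i &
      forall i j : 'I_d, adj (v i) (v j) = (i.+1 == j :> nat) || (j.+1 == i :> nat)].

(* G is a caterpillar C(alpha_0, ..., alpha_(d-1)). *)
Definition caterpillar (G : sgraph) (d : nat) (alpha : 'I_d -> nat) : Prop :=
  tree G /\
  exists2 v : 'I_d -> G, spine v &
    forall i : 'I_d, alpha i = #|[set x in neighbors (v i) | leaf x]|.

Definition proper_coloring (G : sgraph) (N : nat) (k : {ffun G -> 'I_N}) : bool :=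
  [forall x, forall y, adj x y ==> (k x != k y)].

(* The chromatic symmetric function specialised to N variables, that is,
   with x_i = 0 for i > N. *)
Definition chromatic (G : sgraph) (N : nat) : {mpoly rat[N]} :=
  \sum_(k : {ffun G -> 'I_N} | proper_coloring k) \prod_(x : G) 'X_(k x).

Definition is_intpart (s : seq nat) : bool := sorted geq s && (0%N \notin s).

Definition intpart : Type := {s : seq nat | is_intpart s}.

Definition e_basis (la : intpart) (N : nat) : {mpoly rat[N]} :=
  \prod_(k <- val la) mesym N rat k.

(* X_G = \sum_la c_la e_la in the ring of symmetric functions.  This ring is the
   (graded) projective limit of the rings of symmetric polynomials in N
   variables, so an equality in it is an equality for every N, with
   coefficients independent of N. *)
Definition e_expansion (G : sgraph) (c : {fsfun intpart -> rat with 0}) : Prop :=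
  forall N : nat, chromatic G N = \sum_(la <- finsupp c) c la *: e_basis la N.

(* The e_la are a basis, so the expansion c is unique. *)
Definition e_positive (G : sgraph) : Prop :=
  exists2 c : {fsfun intpart -> rat with 0}, e_expansion G c & forall la, 0 <= c la.

(* Main.v *)
Require Import Defs.
From mathcomp Require Import all_boot all_order all_algebra.
From mathcomp Require Import finmap mpoly.
From mathcomp Require Import all_field ring lra zify.

Set Implicit Arguments.
Unset Strict Implicit.
Unset Printing Implicit Defensive.

Import Order.TTheory GRing.Theory Num.Theory.
Local Open Scope ring_scope.

(** The larger side of the inequality is the sum of dist(x, y) - 1 over all
pairs of vertices, that is, the Wiener index of the caterpillar minus
binomial(n, 2).  The Wiener index of a tree is also the sum over its edges of
the product of the sizes of the two components left by the removal of the edge.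
An edge at a leaf contributes n - 1; removing the spine edge after v_c
contributes s_c (n - s_c), where s_c = sum_{j <= c} (alpha_j + 1).  Hence
([wiener_cuts]) the claim is equivalent to
  sum_{ceil(n/2) <= k <= n-2} k (n - k) <= sum_c s_c (n - s_c),
and it is enough that each k of that range is the larger of s_c and n - s_c for
some c: different k then use different c.

That such a c exists is the case of two parts of a theorem of Wolfgang: an
e-positive connected graph with n = k + l vertices has a vertex set A of size l
such that A and its complement both induce connected subgraphs.  The usual proof
compares the coefficients of the power sums p_n and p_k p_l.  The proof below
detects these coefficients by evaluation at roots of unity.

- At the n-th roots of unity every e_la with la a partition of n vanishes,
  except e_n = +-1, so X_G takes the value +-c_(n) there.  For a tree this value is
  nonzero ([tree_sum_neq0]): after expansion of the product over the edges of
  1 - [equal colours at both ends], each term that omits an edge is killed by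
  a cyclic shift of the colours on one side of that edge.  So c_(n) > 0
  ([tree_coef_neq0]).
- At the k-th roots of unity together with the l-th roots multiplied by an
  unknown X, the coefficient of X^l in (-1)^n e_la is nonnegative for every
  partition la of n, and it is 1 for la = (n) ([part_coef_ge0],
  [part_coef_full]).  By e-positivity the coefficient of X^l in X_G is
  nonzero.  It is a sum over the sets A of l vertices that receive the colours
  of the second kind, and the same shift argument kills each A for which A or
  its complement is disconnected ([block_coef_neq0], [e_positive_cut]).

In a caterpillar, if A and its complement are connected and have at least two
vertices each, then every leaf lies on the side of its neighbour, and one of the
two sides consists of an initial segment of the spine with its leaves
([caterpillar_cut]). *)

(** * Shifting the colours on a set of vertices *)

Section Recolor.
Variables (V C : finType).

Definition recolor (s : C -> C) (B : {set V}) (k : {ffun V -> C}) :=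
  [ffun x => if x \in B then s (k x) else k x].

Lemma recolor_inj s B : injective s -> injective (recolor s B).
Proof.
move=> s_inj k1 k2 /ffunP eq12; apply/ffunP=> x.
by have:= eq12 x; rewrite !ffunE; case: ifP => // _ /s_inj.
Qed.

(** Recolouring permutes the colourings satisfying P and multiplies the sum by
t, so the sum is fixed by multiplication by t <> 1. *)
Lemma sum_recolor_eq0 (R : idomainType) s B (P : pred {ffun V -> C})
    (w : {ffun V -> C} -> R) (t : R) :
    injective s -> t != 1 -> (forall k, P (recolor s B k) = P k) ->
    (forall k, P k -> w (recolor s B k) = t * w k) ->
  \sum_(k | P k) w k = 0.
Proof.
move=> s_inj t1 PE wE; apply/eqP.
have: \sum_(k | P k) w k = t * \sum_(k | P k) w k.
  rewrite {1}(reindex_inj (recolor_inj s_inj (B := B))) /= mulr_sumr.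
  by apply: eq_big => [k|k]; rewrite PE // => /wE.
move/eqP; rewrite -{1}[X in X == _]mul1r -subr_eq0 -mulrBl mulf_eq0.
by rewrite subr_eq0 eq_sym (negPf t1).
Qed.

Lemma prod_recolor (R : comNzRingType) (s : C -> C) (B : {set V})
    (y : C -> R) (z : R) (k : {ffun V -> C}) :
    (forall x, x \in B -> y (s (k x)) = z * y (k x)) ->
  \prod_x y (recolor s B k x) = z ^+ #|B| * \prod_x y (k x).
Proof.
move=> yE; rewrite (bigID (mem B)) [in RHS](bigID (mem B)) /= mulrA.
congr (_ * _); last by apply: eq_bigr => x /negPf xB; rewrite ffunE xB.
rewrite -prodr_const -big_split /=; apply: eq_bigr => x xB.
by rewrite ffunE xB yE.
Qed.

End Recolor.

Lemma prim_ordS (R : nzRingType) n (z : R) (i : 'I_n) :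
  n.-primitive_root z -> z ^+ ordS i = z * z ^+ i.
Proof. by move=> pz; rewrite /= prim_expr_mod // exprS. Qed.

Lemma prim_expr_neq1 (R : nzRingType) n (z : R) b :
  n.-primitive_root z -> (0 < b < n)%N -> z ^+ b != 1.
Proof.
move=> pz /andP[b0 bn]; rewrite -(prim_order_dvd pz).
by apply/negP=> /(dvdn_leq b0); rewrite leqNgt bn.
Qed.

(** * Proper colourings of a tree weighted by roots of unity *)

Section TreeSum.
Variable G : sgraph.

(** Each undirected edge appears once, oriented by the enumeration of the
vertices, so that a product over [edges] has one factor per edge. *)
Definition edges : {set G * G} :=
  [set e | adj e.1 e.2 && (enum_rank e.1 < enum_rank e.2)%N].

Lemma adj_edges (x y : G) : adj x y = ((x, y) \in edges) || ((y, x) \in edges).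
Proof.
rewrite !inE /= [adj y x]adj_sym -andb_orr; case xy: (adj x y) => //=.
rewrite -neq_ltn; apply/esym; apply: contraTneq xy => /ord_inj/enum_rank_inj ->.
by rewrite adj_irrefl.
Qed.

Definition respects (C : finType) (S : {set G * G}) (k : {ffun G -> C}) :=
  [forall e in S, k e.1 == k e.2].

(** A colouring is proper when the product over the edges of
1 - [k e.1 = k e.2] is 1 rather than 0; the right-hand side expands it. *)
Lemma sum_proper (R : comNzRingType) N (w : {ffun G -> 'I_N} -> R) :
  \sum_(k | proper_coloring k) w k =
  \sum_(S in powerset edges) (-1) ^+ #|S| * \sum_(k | respects S k) w k.
Proof.
under [RHS]eq_bigr do rewrite mulr_sumr big_mkcond /=.
rewrite exchange_big /= big_mkcond /=; apply: eq_bigr => k _.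
have -> : (if proper_coloring k then w k else 0) =
  w k * \prod_(e in edges) (1 - (k e.1 == k e.2)%:R).
  case: ifPn => [/forallP pk|].
    rewrite big1 ?mulr1 // => -[x y]; rewrite inE /= => /andP[xy _].
    by move/forallP/(_ y)/implyP/(_ xy): (pk x) => /negPf->; rewrite subr0.
  rewrite negb_forall => /existsP[x]; rewrite negb_forall => /existsP[y].
  rewrite negb_imply negbK => /andP[]; rewrite adj_edges => /orP xy /eqP kxy.
  by case: xy => xy; rewrite (bigD1 _ xy) /= kxy eqxx subrr mul0r mulr0.
(* [bigA_distr] expands products over a whole type, hence the factors 0 + 1
   at the pairs that are not edges: they kill every S not inside [edges]. *)
rewrite big_mkcond /=.
under eq_bigr => e _.
  rewrite (_ : (if _ then _ else _) =
    (if e \in edges then - (k e.1 == k e.2)%:R else 0) + 1).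
    over.
  by case: ifP; rewrite ?add0r // addrC.
rewrite bigA_distr mulr_sumr [RHS]big_mkcond; apply: eq_bigr => S _.
rewrite -big_mkcond powersetE /=; case: ifPn => [SE|].
  rewrite (eq_bigr (fun e => -1 * (k e.1 == k e.2)%:R)); last first.
    by move=> e /(subsetP SE) ->; rewrite mulN1r.
  rewrite big_split prodr_const mulrCA; case: ifPn => [/forall_inP rk|].
    by rewrite big1 ?mulr1 // => e /rk ->.
  rewrite negb_forall => /existsP[e]; rewrite negb_imply => /andP[eS /negPf ke].
  by rewrite (bigD1 e) //= ke mul0r !mulr0.
case/subsetPn => e eS eE.
by rewrite (bigD1 e) //= (negPf eE) mul0r mulr0.
Qed.

(** B is the component of an endpoint a of an edge (a, b) missing from S, in
the graph with edge set S: a path from a to b there would close to a cycle of G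
with that edge. *)
Lemma tree_cut (S : {set G * G}) : acyclic G -> S \proper edges ->
  exists B : {set G}, [/\ (0 < #|B| < #|G|)%N &
    forall e, e \in S -> (e.1 \in B) = (e.2 \in B)].
Proof.
move=> acG /properP[SE [[a b] abE abS]].
pose R := [rel x y | ((x, y) \in S) || ((y, x) \in S)].
have R_adj : subrel R (@adj G).
  by move=> x y /= /orP[] /(subsetP SE); rewrite adj_edges => ->; rewrite ?orbT.
have R_sym : connect_sym R.
  by apply: sym_connect_sym => x y /=; rewrite orbC.
exists [set x | connect R a x]; split; last first.
  move=> [x y] xyS; rewrite !inE /=; apply: (same_connect_r R_sym).
  by apply: connect1; rewrite /= xyS.
apply/andP; split; first by apply/card_gt0P; exists a; rewrite inE connect0.
rewrite -cardsT; apply: proper_card; apply/properP; split; first exact: subsetT.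
exists b; rewrite // inE; apply/negP=> /connectP[p pp bp].
move: abE; rewrite inE /= => /andP[ab rab].
case/shortenP: pp bp => q pq uq _ bq.
apply: (acG (a :: q)); last first.
  apply/andP; split => //=; rewrite rcons_path (sub_path R_adj) //=.
  by rewrite -bq adj_sym.
case: q pq uq bq => [|c [|c' q]] //=.
  by move=> _ _ ba; rewrite ba adj_irrefl in ab.
move=> /andP[acS _] _ bc; move: acS; rewrite -bc (negPf abS) /=.
by move/(subsetP SE); rewrite inE /= => /andP[_]; rewrite ltnNge ltnW.
Qed.

(** In the expansion of [sum_proper] only S = edges survives: a smaller S
admits a cut B, and a shift of the colours on B multiplies the weights by
z ^ #|B|, which is not 1.  For S = edges connectedness leaves the #|G| constant
colourings, all of weight 1. *)
Lemma tree_sum_neq0 (R : numDomainType) (z : R) :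
    tree G -> #|G|.-primitive_root z ->
  \sum_(k : {ffun G -> 'I_#|G|} | proper_coloring k) \prod_x z ^+ k x != 0.
Proof.
move=> [G0 cG acG] pz; rewrite sum_proper (bigD1 edges) ?powersetE //=.
rewrite [X in _ + X]big1.
  have constE (k : {ffun G -> 'I_#|G|}) :
      respects edges k -> forall x y, k x = k y.
    move=> /forall_inP rk x y; have /connectP[p pp ->] := cG x y.
    elim: p x pp => //= u p IH x /andP[xu /IH <-]; apply/eqP.
    by move: xu; rewrite adj_edges => /orP[] /rk //=; rewrite eq_sym.
  suff -> : \sum_(k : {ffun G -> 'I_#|G|} | respects edges k)
      \prod_x z ^+ k x = #|G|%:R :> R.
    by rewrite addr0 mulf_neq0 ?signr_eq0 // pnatr_eq0 -lt0n.
  case/card_gt0P: (G0) => r _.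
  transitivity (\sum_(c : 'I_#|G|) (1 : R)); last first.
    by rewrite sumr_const card_ord.
  rewrite (reindex_onto (fun c : 'I_#|G| => [ffun=> c] : {ffun G -> 'I_#|G|})
    (fun k => k r)) /=; last first.
    by move=> k /constE kc; apply/ffunP => x; rewrite ffunE.
  apply: eq_big => [c|c _].
    rewrite ffunE eqxx andbT; apply/forall_inP => e _.
    by rewrite !ffunE.
  under eq_bigr do rewrite ffunE.
  by rewrite prodr_const exprAC (prim_expr_order pz) expr1n.
move=> S; rewrite powersetE => /andP[SE SnE].
have [|B [Bn BS]] := tree_cut (S := S) acG; first by rewrite properEneq SnE.
rewrite (sum_recolor_eq0 (s := @ordS #|G|) (B := B) (t := z ^+ #|B|)) ?mulr0 //.
- exact: can_inj (@ordSK _).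
- exact: prim_expr_neq1 pz Bn.
- move=> k; apply: eq_forallb_in => e eS; rewrite !ffunE (BS e eS).
  by case: ifP => // _; rewrite (can_eq (@ordSK _)).
move=> k _; apply: (prod_recolor (y := fun c : 'I_ #|G| => z ^+ c)) => x _.
exact: prim_ordS.
Qed.

End TreeSum.

Lemma prod_subr_unity_field (F : fieldType) n (z a b : F) :
  n.-primitive_root z -> \prod_(i < n) (a - z ^+ i * b) = a ^+ n - b ^+ n.
Proof.
move=> pz; have n0 := prim_order_gt0 pz.
have [->|b0] := eqVneq b 0.
  under eq_bigr do rewrite mulr0 subr0.
  by rewrite prodr_const card_ord expr0n gtn_eqF ?subr0.
have:= congr1 (fun p => b ^+ n * p.[a / b]) (factor_Xn_sub_1 pz).
rewrite horner_prod hornerD hornerXn hornerN hornerC mulrBr mulr1.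
rewrite -exprMn mulrCA mulfV // mulr1.
have bn : b ^+ n = \prod_(i < n) b by rewrite prodr_const card_ord.
rewrite big_mkord [in LHS]bn => <-; rewrite -big_split; apply: eq_bigr => i _ /=.
by rewrite hornerXsubC mulrBr mulrCA mulfV // mulr1 [b * _]mulrC.
Qed.

(** Homogeneous form of the factorisation of X^n - 1; passing to the fraction
field of R allows division by b. *)
Lemma prod_subr_unity (F : fieldType) (R : idomainType) (f : {rmorphism F -> R})
    n (z : F) (a b : R) : n.-primitive_root z ->
  \prod_(i < n) (a - f (z ^+ i) * b) = a ^+ n - b ^+ n.
Proof.
move=> pz; pose h : {rmorphism R -> {fraction R}} := @tofrac R.
have pz' : n.-primitive_root (h (f z)).
  by rewrite (fmorph_primitive_root (h \o f)).
apply/eqP; rewrite -tofrac_eq -/(h _) -/(h _) rmorph_prod rmorphB !rmorphXn /=.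
rewrite -(prod_subr_unity_field _ _ pz'); apply/eqP/eq_bigr => i _.
by rewrite rmorphB rmorphM !rmorphXn.
Qed.

(** * The e-expansion evaluated at the roots of a polynomial *)

Section Expansion.
Variable G : sgraph.

Lemma chromatic_eval (R : comNzRingType) (f : {rmorphism rat -> R}) N
    (x : 'I_N -> R) :
  mmap f x (chromatic G N) =
  \sum_(k : {ffun G -> 'I_N} | proper_coloring k) \prod_v x (k v).
Proof.
rewrite rmorph_sum; apply: eq_bigr => k _; rewrite rmorph_prod.
by apply: eq_bigr => v _; rewrite /= mmapX mmap1U.
Qed.

Lemma chromatic_homog N : chromatic G N \is #|G|.-homog.
Proof.
apply: rpred_sum => k _.
have -> : #|G| = (\sum_(v : G) 1)%N by rewrite sum1_card.
apply: (big_rec2 (fun p (d : nat) => p \is d.-homog)) => [|v p d _ pd].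
  exact: dhomog1.
by apply: dhomogM => //; rewrite dhomogX /= mdeg1.
Qed.

Lemma e_basis_homog la N : e_basis la N \is (sumn (val la)).-homog.
Proof.
rewrite /e_basis; elim: (val la) => [|m s IH]; rewrite ?big_nil ?big_cons /=.
  exact: dhomog1.
by apply: dhomogM => //; apply: dhomog_mesym.
Qed.

(** X_G is homogeneous of degree #|G|, so the terms of other degrees cancel.
Discarding them makes the sign (-1) ^ N in [chromatic_e_eval] common to all
remaining terms. *)
Lemma e_expansion_homog c N : e_expansion G c ->
  chromatic G N =
  \sum_(la <- finsupp c | sumn (val la) == #|G|) c la *: e_basis la N.
Proof.
move=> cE; rewrite -[LHS](pihomog_dE (chromatic_homog N)) cE raddf_sum /=.
rewrite [RHS]big_mkcond; apply: eq_bigr => la _; rewrite linearZ /=.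
have [<-|ne] := eqVneq; first by rewrite pihomog_dE // e_basis_homog.
by rewrite (pihomog_ne0 ne (e_basis_homog la N)) scaler0.
Qed.

(** Vieta: up to sign, the elementary symmetric polynomials of the values
x c are the coefficients of the monic polynomial with these roots. *)
Lemma e_basis_eval (R : idomainType) (f : {rmorphism rat -> R}) N
    (x : 'I_N -> R) la : sumn (val la) = N ->
  mmap f x (e_basis la N) = (-1) ^+ N *
  \prod_(m <- val la) (\prod_c ('X - (x c)%:P))`_(N - m).
Proof.
move=> sN; have: (sumn (val la) <= N)%N by rewrite sN.
rewrite -[in (-1) ^+ N]sN rmorph_prod /=.
elim: (val la) => [|m s IH] /= le_sN; first by rewrite !big_nil mulr1.
rewrite !big_cons IH ?(leq_trans _ le_sN) ?leq_addl //.
have ltmN : (m < N.+1)%N by rewrite ltnS (leq_trans _ le_sN) ?leq_addr.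
have:= mroots_coeff [tuple x c | c < N] (Ordinal ltmN) => /=.
rewrite big_image /= => ->; rewrite exprD.
set y := \prod_(_ <- _) _.
suff -> : meval (tnth [tuple x c | c < N]) (mesym N R m) =
    mmap f x (mesym N rat m).
  by rewrite -(mulrA _ _ y) [RHS]mulrACA -expr2 sqrr_sign mul1r mulrCA.
rewrite /mesym !rmorph_sum; apply: eq_bigr => h _.
rewrite !rmorph_prod; apply: eq_bigr => i _ /=.
by rewrite mmapX mmap1U mevalXU tnth_mktuple.
Qed.

Lemma chromatic_e_eval (R : idomainType) (f : {rmorphism rat -> R}) N
    (x : 'I_N -> R) c : e_expansion G c -> #|G| = N ->
  \sum_(k : {ffun G -> 'I_N} | proper_coloring k) \prod_v x (k v) =
  (-1) ^+ N * \sum_(la <- finsupp c | sumn (val la) == N)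
    f (c la) * \prod_(m <- val la) (\prod_c ('X - (x c)%:P))`_(N - m).
Proof.
move=> cE GN; rewrite -(chromatic_eval f) (e_expansion_homog _ cE) GN.
rewrite rmorph_sum mulr_sumr; apply: eq_bigr => la /eqP sN /=.
by rewrite mmapZ (e_basis_eval _ _ sN) mulrCA.
Qed.
End Expansion.

(** * The coefficient of e_n for a tree *)

Lemma sumn_rem m s : m \in s -> sumn s = (m + sumn (rem m s))%N.
Proof. by move=> ms; rewrite (perm_sumn (perm_to_rem ms)). Qed.

Lemma sumn_gt0 s : 0%N \notin s -> (0 < size s)%N -> (0 < sumn s)%N.
Proof.
by case: s => [|[|m] s] //=; rewrite inE.
Qed.

Lemma part_bound s m : 0%N \notin s -> m \in s -> s <> [:: sumn s] ->
  (0 < m < sumn s)%N.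
Proof.
move=> s0 ms sn; apply/andP; split.
  by rewrite lt0n; apply: contraNneq s0 => <-.
rewrite (sumn_rem ms) -[X in (X < _)%N]addn0 ltn_add2l; apply: sumn_gt0.
  by apply: contra s0; apply: mem_rem.
rewrite size_rem // lt0n; apply/eqP=> sz; case: sn.
by case: s s0 ms sz => [|a [|b s]] //= _ _ _; rewrite addn0.
Qed.

Lemma intpart0 (la : intpart) : 0%N \notin val la.
Proof. by case/andP: (valP la). Qed.

(** At the n-th roots of unity the polynomial with these roots is X^n - 1,
so every e_la with a part strictly between 0 and n vanishes. *)
Lemma tree_coef_neq0 (G : sgraph) c : tree G -> e_expansion G c ->
  exists2 la, val la = [:: #|G|] & c la != 0.
Proof.
move=> tG cE; have [G0 _ _] := tG.
have [z pz] := C_prim_root_exists G0.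
have:= tree_sum_neq0 tG pz.
rewrite (chromatic_e_eval (@ratr algC) (fun i => z ^+ i) cE erefl).
rewrite mulf_eq0 signr_eq0 /= => nz.
have [/hasP[la la_c /andP[/eqP la1 c0]]|no] :=
  boolP (has (fun la : intpart => (val la == [:: #|G|]) && (c la != 0))
    (finsupp c)).
  by exists la.
case/eqP: nz; rewrite big_seq_cond big1 // => la /andP[la_c /eqP sla].
have la_n : val la <> [:: sumn (val la)].
  move=> la1; case/hasP: no; exists la => //.
  by rewrite la1 sla eqxx -mem_finsupp.
have [|m ml] := hasP (_ : has predT (val la)).
  rewrite has_predT lt0n; apply: contraTneq G0 => /size0nil la0.
  by rewrite -sla la0.
have := part_bound (intpart0 la) ml la_n; rewrite sla => /andP[m0 mn] _.
rewrite (big_rem m) //= -(big_mkord xpredT (fun i => 'X - (z ^+ i)%:P)).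
rewrite (factor_Xn_sub_1 pz) coefB coefXn coef1.
by rewrite subn_eq0 leqNgt mn ltn_eqF ?subrr ?mul0r ?mulr0 // ltn_subrL m0 G0.
Qed.

(** * Colourings with two kinds of colours *)

(** Connectedness of the subgraph induced by A, phrased by edge cuts: a colour
shift on a subset without an edge to the rest of A is what makes colouring sums
vanish, and no induced subgraph has to be formed. *)
Definition cut_connected (G : sgraph) (A : {set G}) :=
  forall B : {set G}, B \subset A -> B != set0 -> B != A ->
  exists x y, [/\ x \in B, y \in A :\: B & adj x y].

Section TwoBlocks.
Variables (k l : nat) (z w : algC).
Hypotheses (pz : k.-primitive_root z) (pw : l.-primitive_root w).

Definition block_val (c : 'I_(k + l)) : algC :=
  match split c with inl i => z ^+ i | inr j => w ^+ j end.

Definition in_second (c : 'I_(k + l)) : bool := ~~ split c.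

(** The first k variables are the k-th roots of unity, the last l are the l-th
roots times an unknown, whose exponent then counts the vertices that have a
colour of the second kind. *)
Definition block_var (c : 'I_(k + l)) : {poly algC} :=
  (block_val c)%:P * 'X ^+ in_second c.

Lemma prod_block_var :
  \prod_c ('X - (block_var c)%:P) = ('X^k - 1) * ('X^l - ('X^l)%:P).
Proof.
pose f : {rmorphism algC -> {poly {poly algC}}} := polyC \o polyC.
rewrite big_split_ord /=; congr (_ * _).
  rewrite -[X in _ - X](expr1n _ k) -(prod_subr_unity f _ _ pz).
  apply: eq_bigr => i _; congr (_ - _).
  rewrite /block_var /block_val /in_second -[lshift l i]/(unsplit (inl i)).
  by rewrite unsplitK /= !mulr1.
rewrite polyC_exp -(prod_subr_unity f _ _ pw).
apply: eq_bigr => i _; congr (_ - _).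
rewrite /block_var /block_val /in_second -[rshift k i]/(unsplit (inr i)).
by rewrite unsplitK expr1 polyCM.
Qed.

Definition block_map (f : 'I_k -> 'I_k) (g : 'I_l -> 'I_l) (c : 'I_(k + l)) :=
  unsplit (match split c with inl i => inl (f i) | inr j => inr (g j) end).

Lemma block_map_inj f g :
  injective f -> injective g -> injective (block_map f g).
Proof.
move=> fI gI c d /(can_inj unsplitK) E; apply: (can_inj splitK); move: E.
by case: (split c) (split d) => i [j|j] // [] => [/fI|/gI] ->.
Qed.

Lemma in_second_map f g c : in_second (block_map f g c) = in_second c.
Proof. by rewrite /in_second /block_map unsplitK; case: split. Qed.

Section Coef.
Variable G : sgraph.
Implicit Type A B : {set G}.

Definition second_class (h : {ffun G -> 'I_(k + l)}) : {set G} :=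
  [set v | in_second (h v)].

(** Shift argument for a fixed class A of vertices with colours of the second
kind.  The Boolean b selects the side, A or its complement, and B is a union of
components of that side.  The shift s keeps the kind of a colour, so the edges
leaving B towards the other side stay properly coloured. *)
Lemma class_sum_eq0 A B b s (t : algC) :
    injective s -> (forall c, in_second (s c) = in_second c) ->
    (forall c, in_second c = b -> block_val (s c) = t * block_val c) ->
    t ^+ #|B| != 1 -> (forall x, x \in B -> (x \in A) = b) ->
    (forall x y, x \in B -> y \notin B -> (y \in A) = b -> ~~ adj x y) ->
  \sum_(h | proper_coloring h && (second_class h == A))
     \prod_v block_val (h v) = 0.
Proof.
move=> sI s2 sv tB BA Bcut.
have cls h : second_class (recolor s B h) = second_class h.
  by apply/setP=> v; rewrite !inE ffunE; case: ifP; rewrite ?s2.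
apply: (sum_recolor_eq0 (s := s) (B := B) (t := t ^+ #|B|)) => // h.
  rewrite cls andbC [RHS]andbC; case: eqP => //= hA.
  have hE v : in_second (h v) = (v \in A) by rewrite -hA inE.
  apply: eq_forallb => x; apply: eq_forallb => y.
  case xy: (adj x y) => //=; rewrite !ffunE.
  case xB: (x \in B); case yB: (y \in B) => //.
  - by rewrite (inj_eq sI).
  - have yA: (y \in A) != b.
      by apply: contraTneq xy => /(Bcut _ _ xB (negbT yB)).
    by congr negb; apply/eqP/eqP => /(congr1 in_second);
      rewrite ?s2 !hE (BA _ xB) => /eqP; rewrite eq_sym (negPf yA).
  - have xA: (x \in A) != b.
      rewrite adj_sym in xy.
      by apply: contraTneq xy => /(Bcut _ _ yB (negbT xB)).
    by congr negb; apply/eqP/eqP => /(congr1 in_second);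
      rewrite ?s2 !hE (BA _ yB) => /eqP; rewrite (negPf xA).
move=> /andP[_ /eqP hA]; apply: prod_recolor => x /BA xb.
by apply: sv; rewrite -xb -hA inE.
Qed.

Lemma block_monomial (h : {ffun G -> 'I_(k + l)}) :
  \prod_v block_var (h v) =
  (\prod_v block_val (h v))%:P * 'X^#|second_class h|.
Proof.
rewrite big_split /= -rmorph_prod prodrXr; congr (_ * 'X^_).
rewrite -sum1_card [RHS]big_mkcond; apply: eq_bigr => v _.
by rewrite inE; case: in_second.
Qed.

(** The coefficient of 'X^l collects the colourings whose second class has l
elements; grouped by that class, one group has nonzero sum, and
[class_sum_eq0] then forbids cuts on either side. *)
Lemma block_coef_neq0 : #|G| = (k + l)%N ->
    (\sum_(h : {ffun G -> 'I_(k + l)} | proper_coloring h)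
       \prod_v block_var (h v))`_l != 0 ->
  exists A, [/\ #|A| = l, cut_connected A & cut_connected (~: A)].
Proof.
move=> Gkl nz; pose T A :=
  \sum_(h | proper_coloring h && (second_class h == A)) \prod_v block_val (h v).
have [A /andP[/eqP Al nzA]] : exists A, (#|A| == l) && (T A != 0).
  apply/existsP; apply: contraNT nz; rewrite negb_exists => /forallP no.
  rewrite coef_sum (partition_big second_class xpredT) //= big1 // => A _.
  have {no} := no A; rewrite negb_and negbK.
  have coefE h : proper_coloring h && (second_class h == A) ->
      (\prod_v block_var (h v))`_l =
      if #|A| == l then \prod_v block_val (h v) else 0.
    move=> /andP[_ /eqP hA]; rewrite block_monomial coefCM coefXn hA eq_sym.
    by case: eqP; rewrite ?mulr1 ?mulr0.
  rewrite (eq_bigr _ coefE); case: eqP => /= _ => [/eqP //|_].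
  exact: big1.
have Ak : #|~: A| = k.
  by apply/eqP; rewrite -(eqn_add2r l) -Gkl -Al addnC cardsC.
have no_cut b (D := if b then A else ~: A) s t m :
    m.-primitive_root t -> #|D| = m -> injective s ->
    (forall c, in_second (s c) = in_second c) ->
    (forall c, in_second c = b -> block_val (s c) = t * block_val c) ->
  cut_connected D.
  move=> pt Dm sI s2 sv B BD B0 BnD.
  have inD x : (x \in D) = ((x \in A) == b).
    by rewrite /D; case: (b); rewrite ?inE; case: (x \in A).
  have [/existsP[x /existsP[y /and3P[xB yD xy]]]|nocut] :=
      boolP [exists x, exists y, [&& x \in B, y \in D :\: B & adj x y]].
    by exists x, y.
  case/eqP: nzA; apply: (class_sum_eq0 (b := b) sI s2 sv (B := B)).
  - apply: prim_expr_neq1 pt _; rewrite card_gt0 B0 -Dm.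
    by apply: proper_card; rewrite properEneq BnD.
  - by move=> x /(subsetP BD); rewrite inD => /eqP.
  move=> x y xB yB yA; apply: contra nocut => xy.
  apply/existsP; exists x; apply/existsP; exists y.
  by rewrite xB inE yB inD yA eqxx.
exists A; split=> //.
- apply: (no_cut true (block_map id (@ordS l)) w l) => //.
  + by apply: block_map_inj => //; exact: can_inj (@ordSK _).
  + exact: in_second_map.
  rewrite /in_second /block_val /block_map => c; rewrite unsplitK.
  by case: split => // j _; exact: prim_ordS.
apply: (no_cut false (block_map (@ordS k) id) z k) => //.
- by apply: block_map_inj => //; exact: can_inj (@ordSK _).
- exact: in_second_map.
rewrite /in_second /block_val /block_map => c; rewrite unsplitK.
by case: split => // j _; exact: prim_ordS.
Qed.
End Coef.
End TwoBlocks.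

(** * Two-part cuts of e-positive trees *)

Section PartitionCoef.
Variables (k l : nat).
Hypotheses (l0 : (0 < l)%N) (lk : (l <= k)%N).
Let n := (k + l)%N.
Let P : {poly {poly algC}} := ('X^k - 1) * ('X^l - ('X^l)%:P).

Let k0 : (0 < k)%N. Proof. exact: leq_trans lk. Qed.

Let PE : P = 'X^n - 'X^l - ('X^l)%:P * 'X^k + ('X^l)%:P.
Proof. by rewrite /P /n exprD; ring. Qed.

Let coefPE i : P`_i =
  (i == n)%:R - (i == l)%:R - 'X^l *+ (i == k) + 'X^l *+ (i == 0)%N.
Proof.
by rewrite PE !coefD !coefN coefCM !coefXn coefC mulr_natr; case: (i == 0%N).
Qed.

Let P0 : P`_0 = 'X^l.
Proof.
by rewrite coefPE eqxx !ltn_eqF ?addn_gt0 ?l0 ?k0 //= !subr0 add0r.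
Qed.

(** P`_(n - m) is (-1)^m e_m, evaluated at the k-th roots of unity and the
l-th roots times 'X. *)
Let P_part m : (0 < m < n)%N ->
  P`_(n - m) = - ((m == k)%:R + 'X^l *+ (m == l)).
Proof.
move=> /andP[m0 mn].
have sub_eq a b : (a + b = n)%N -> (n - m == a)%N = (m == b)%N.
  by move=> ab; rewrite -(eqn_add2r m) subnK 1?ltnW // -ab eqn_add2l eq_sym.
rewrite coefPE (sub_eq n 0%N) ?addn0 // (sub_eq 0%N n) // (sub_eq k l) //.
rewrite (sub_eq l k) 1?addnC // (gtn_eqF m0) (ltn_eqF mn).
by rewrite sub0r addr0 opprD.
Qed.

Lemma part_coef_full s : s = [:: n] -> (\prod_(m <- s) P`_(n - m))`_l = 1.
Proof. by move=> ->; rewrite big_seq1 subnn P0 coefXn eqxx. Qed.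

(** By [P_part] each part other than n contributes a factor with nonpositive
coefficients, which vanishes unless the part is k or l.  If k occurs, the other
parts sum to l <= k: either l is the only one and the two signs cancel, or one of
them is less than l and its factor vanishes.  If neither k nor n occurs, there
are at least two factors, each a multiple of 'X^l, and the coefficient is 0. *)
Lemma part_coef_ge0 s : 0%N \notin s -> sumn s = n ->
  0 <= (\prod_(m <- s) P`_(n - m))`_l.
Proof.
move=> s0 sn; have [/part_coef_full->|/eqP nsn] := eqVneq s [:: n].
  exact: ler01.
have bound m : m \in s -> (0 < m < n)%N.
  by move=> ms; rewrite -sn; apply: part_bound => //; rewrite sn.
have [ks|kns] := boolP (k \in s).
  have sr : sumn (rem k s) = l.
    by apply/eqP; rewrite -(eqn_add2l k) -(sumn_rem ks) sn.
  rewrite (big_rem k) //= P_part ?bound // eqxx.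
  have [->|/eqP rl] := eqVneq (rem k s) [:: l].
    rewrite big_seq1 P_part ?eqxx; last first.
      by rewrite l0 -[X in (X < _)%N]add0n ltn_add2r k0.
    rewrite mulrNN eq_sym; case: eqP => [_|_].
      rewrite mulr1n !mulrDl mulrDr !mul1r mulrDr mulr1 !coefD coefXn.
      rewrite -exprD coefXn coef1 !eqxx.
      by rewrite !addr_ge0 ?ler0n.
    by rewrite mulr0n addr0 mul1r add0r coefXn eqxx ler01.
  have r0 : 0%N \notin rem k s by apply: contra s0; apply: mem_rem.
  have [|m mr] := hasP (_ : has predT (rem k s)).
    rewrite has_predT lt0n; apply: contraTneq l0 => /size0nil e.
    by rewrite -sr e.
  have:= part_bound r0 mr; rewrite sr => /(_ rl)/andP[m0 ml] _.
  rewrite (big_rem m) //= P_part ?bound ?(mem_rem mr) //.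
  rewrite (ltn_eqF ml) (ltn_eqF (leq_trans ml lk)).
  by rewrite mulr0n addr0 oppr0 mul0r mulr0 coef0.
rewrite (eq_big_seq (fun m => (- (m == l)%:R) * 'X^l)); last first.
  move=> m ms; rewrite P_part ?bound //.
  have -> : (m == k) = false by apply: contraNF kns => /eqP <-.
  by rewrite add0r mulNr mulr_natl.
have sz : (1 < size s)%N.
  move: sn nsn; case: (s) => [|a [|b r]] //= sn; last by rewrite -sn addn0.
  by have := addn_gt0 k l; rewrite k0 -/n -sn.
rewrite big_split /= big_const_seq count_predT iter_mulr_1 -exprM coefMXn.
by rewrite -[X in (X < _)%N]muln1 ltn_pmul2l // sz.
Qed.

End PartitionCoef.

(** In the evaluation of X_G the coefficient of 'X^l is, up to sign, a sum of
nonnegative terms, among them c_(n) > 0. *)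
Lemma e_positive_cut (G : sgraph) k l :
    tree G -> e_positive G -> (0 < l <= k)%N -> #|G| = (k + l)%N ->
  exists A : {set G}, [/\ #|A| = l, cut_connected A & cut_connected (~: A)].
Proof.
move=> tG [c cE c0] /andP[l0 lk] Gkl.
have [z pz] := C_prim_root_exists (leq_trans l0 lk).
have [w pw] := C_prim_root_exists l0.
apply: (block_coef_neq0 pz pw Gkl).
have [la laG cla] := tree_coef_neq0 tG cE.
pose f : {rmorphism rat -> {poly algC}} := polyC \o ratr.
rewrite (chromatic_e_eval f _ cE Gkl) (prod_block_var pz pw).
rewrite -signr_odd mulr_sign.
set S := \sum_(_ <- _ | _) _; suff S0 : 0 < S`_l.
  by case: odd; rewrite ?coefN ?oppr_eq0 gt_eqF.
have la_c : la \in finsupp c by rewrite mem_finsupp.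
rewrite /S (big_rem la) //= laG /= addn0 Gkl eqxx.
rewrite coefD coefCM (part_coef_full l0 lk erefl) mulr1.
apply: ltr_pwDl; first by rewrite ltr0q lt_def cla c0.
rewrite coef_sum sumr_ge0 // => mu /eqP smu.
by rewrite coefCM mulr_ge0 ?ler0q ?c0 ?part_coef_ge0 ?intpart0.
Qed.

(** * Connected cuts of a caterpillar *)

Section Caterpillar.
Variables (G : sgraph) (d : nat) (v : 'I_d -> G).
Hypotheses (cG : connected G) (sv : spine v).

(** Two adjacent leaves would form a component of their own, but the spine is
nonempty. *)
Lemma leaf_neighbor x : leaf x -> exists i, neighbors x = [set v i].
Proof.
have [d0 vI nleaf _] := sv.
move=> /cards1P[y Nx]; have xy : adj x y.
  by move/setP/(_ y): Nx; rewrite !inE eqxx.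
suff [i yi] : exists i, y = v i by exists i; rewrite Nx yi.
apply/nleaf/negP => /cards1P[x' Ny].
have Ny' : neighbors y = [set x].
  have: x \in neighbors y by rewrite inE adj_sym.
  by rewrite Ny !inE => /eqP ->.
have cl : closed (@adj G) [set x; y].
  apply: intro_closed => [|a b ab]; first exact/sym_connect_sym/adj_sym.
  rewrite !inE => /orP[] /eqP ea; rewrite {}ea in ab.
    have: b \in neighbors x by rewrite inE.
    by rewrite Nx inE => ->; rewrite orbT.
  have: b \in neighbors y by rewrite inE.
  by rewrite Ny' inE => ->.
have := closed_connect cl (cG x (v (Ordinal d0))).
rewrite !inE eqxx /= => /esym vxy.
have /negP : ~~ leaf (v (Ordinal d0)) by apply/nleaf; exists (Ordinal d0).
by case; rewrite /leaf; case/orP: vxy => /eqP ->; rewrite ?Nx ?Ny' cards1.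
Qed.

Lemma leaf_spine i : leaf (v i) = false.
Proof. by have [_ _ nleaf _] := sv; apply/negbTE/nleaf; exists i. Qed.

(** The function idx retracts the caterpillar onto its spine, sending each
leaf to the position of its neighbour. *)
Lemma spine_index : exists idx : G -> 'I_d,
  [/\ forall i, idx (v i) = i,
      forall x, leaf x -> neighbors x = [set v (idx x)] &
      forall x, ~~ leaf x -> x = v (idx x)].
Proof.
have [d0 vI nleaf _] := sv.
have ex x : exists i,
    (leaf x -> neighbors x = [set v i]) /\ (~~ leaf x -> x = v i).
  have [lx|nlx] := boolP (leaf x).
    by have [i Ni] := leaf_neighbor lx; exists i.
  by have [i xi] := (nleaf x).1 nlx; exists i.
have [idx idxP] := fin_all_exists ex; exists idx; split=> [i|x lx|x lx].
- by apply/esym/vI; apply: (idxP (v i)).2; rewrite leaf_spine.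
- exact: (idxP x).1.
exact: (idxP x).2.
Qed.

Variable idx : G -> 'I_d.
Hypotheses (idxv : forall i, idx (v i) = i)
  (idx_leaf : forall x, leaf x -> neighbors x = [set v (idx x)])
  (idx_spine : forall x, ~~ leaf x -> x = v (idx x)).

Lemma card_idx i :
  #|[set x | idx x == i]| = #|[set x in neighbors (v i) | leaf x]|.+1.
Proof.
have -> : [set x | idx x == i] = v i |: [set x in neighbors (v i) | leaf x].
  apply/setP=> x; rewrite !inE; apply/eqP/orP => [<-|[/eqP->//|/andP[vx lx]]].
    have [lx|/idx_spine <-] := boolP (leaf x); last by left.
    have: v (idx x) \in neighbors x by rewrite idx_leaf // inE.
    by rewrite inE adj_sym; right; apply/andP.
  have: v i \in neighbors x by rewrite inE adj_sym.
  by rewrite idx_leaf // inE => /eqP/(congr1 idx); rewrite !idxv.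
by rewrite cardsU1 !inE leaf_spine andbF.
Qed.

Lemma adj_idx x y : adj x y -> (idx x < idx y)%N ->
  [/\ x = v (idx x), y = v (idx y) & idx y = (idx x).+1 :> nat].
Proof.
move=> xy lxy.
have xs : x = v (idx x).
  apply: idx_spine; apply/negP=> lx.
  have: y \in neighbors x by rewrite inE.
  rewrite idx_leaf // inE => /eqP/(congr1 idx); rewrite idxv => e.
  by rewrite e ltnn in lxy.
have ys : y = v (idx y).
  apply: idx_spine; apply/negP=> ly.
  have: x \in neighbors y by rewrite inE adj_sym.
  rewrite idx_leaf // inE => /eqP/(congr1 idx); rewrite idxv => e.
  by rewrite e ltnn in lxy.
split=> //; have [_ _ _ vadj] := sv.
move: xy; rewrite xs ys vadj !idxv => /orP[] /eqP // e.
by move: lxy; rewrite -e ltnNge leqnSn.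
Qed.

(** A leaf in D would be cut off from the rest of D if its neighbour were
outside. *)
Lemma leaf_side (D : {set G}) x : cut_connected D -> (1 < #|D|)%N ->
  x \in D -> v (idx x) \in D.
Proof.
move=> ccD D1 xD; have [lx|/idx_spine <- //] := boolP (leaf x).
have [||| x' [y [/set1P -> yD xy]]] := ccD [set x].
- by rewrite sub1set.
- by rewrite -card_gt0 cards1.
- by apply: contraTneq D1 => <-; rewrite cards1.
have: y \in neighbors x by rewrite inE.
by rewrite idx_leaf // => /set1P <-; case/setDP: yD.
Qed.

(** By [leaf_side] on both sides, A is a union of fibres of idx.  Let c end the
longest initial segment of the spine inside A.  The vertices of index at most c
have only one further edge, towards v (c + 1), which is not in A, so they
exhaust the connected set A. *)
Lemma cut_prefix (A : {set G}) (i0 : 'I_d) : i0 = 0%N :> nat ->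
    cut_connected A -> cut_connected (~: A) ->
    (1 < #|A|)%N -> (1 < #|~: A|)%N -> v i0 \in A ->
  exists c : 'I_d, A = [set x | (idx x <= c)%N].
Proof.
move=> i00 ccA ccA' A1 A'1 vA.
have sideE x : (v (idx x) \in A) = (x \in A).
  apply/idP/idP; last exact: leaf_side.
  by apply: contraLR; rewrite -!in_setC; apply: leaf_side.
pose Q (i : 'I_d) := [forall j : 'I_d, (j <= i)%N ==> (v j \in A)].
have Q0 : Q i0.
  apply/forallP => j; apply/implyP; rewrite i00 leqn0 => /eqP j0.
  by have -> : j = i0 by apply: val_inj; rewrite /= j0 i00.
case: (arg_maxnP (fun i : 'I_d => i : nat) Q0) => c /forallP Qc cmax.
pose B := [set x | (idx x <= c)%N].
have BA : B \subset A.
  by apply/subsetP => x; rewrite inE -sideE => xc; exact: implyP (Qc _) xc.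
exists c; apply/eqP/negPn/negP => BnA.
have [|||x [y [xB /setDP[yA yB] xy]]] := ccA B => //.
- by apply/set0Pn; exists (v c); rewrite inE idxv.
- by rewrite eq_sym.
rewrite !inE -?ltnNge in xB yB.
have [xs ys e] := adj_idx xy (leq_ltn_trans xB yB).
have: Q (idx y).
  apply/forallP => j; apply/implyP; rewrite leq_eqVlt => /orP[/eqP/val_inj ->|].
    by rewrite -ys.
  rewrite e ltnS => jx; exact: implyP (Qc j) (leq_trans jx xB).
by move/cmax => /=; rewrite leqNgt yB.
Qed.

Lemma card_prefix (P : pred 'I_d) :
  #|[set x | P (idx x)]| =
  (\sum_(i | P i) #|[set x in neighbors (v i) | leaf x]|.+1)%N.
Proof.
rewrite -sum1_card (partition_big idx P) => [|x]; last by rewrite inE.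
apply: eq_bigr => i Pi; rewrite -card_idx -sum1_card.
by apply: eq_bigl => x; rewrite !inE andb_idl // => /eqP ->.
Qed.
End Caterpillar.

Lemma caterpillar_card (G : sgraph) d (alpha : 'I_d -> nat) :
  caterpillar G alpha -> #|G| = (\sum_i (alpha i).+1)%N.
Proof.
move=> [[_ cG _] [v sv av]].
have [idx [idxv idxl idxs]] := spine_index cG sv.
have := card_prefix sv idxv idxl idxs xpredT.
rewrite /= -[[set _ | _]]/setT cardsT.
by move=> ->; apply: eq_bigr => i _; rewrite av.
Qed.

Lemma caterpillar_cut (G : sgraph) d (alpha : 'I_d -> nat) (A : {set G}) :
    caterpillar G alpha -> cut_connected A -> cut_connected (~: A) ->
    (1 < #|A|)%N -> (1 < #|~: A|)%N ->
  exists c : 'I_d,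
    (\sum_(i : 'I_d | i <= c) (alpha i).+1)%N = #|A| \/
    (\sum_(i : 'I_d | i <= c) (alpha i).+1)%N = #|~: A|.
Proof.
move=> [[_ cG _] [v sv av]] ccA ccA' A1 A'1.
have [idx [idxv idxl idxs]] := spine_index cG sv.
have [d0 _ _ _] := sv; pose i0 := Ordinal d0.
have prefix := cut_prefix sv idxv idxl idxs (erefl : i0 = 0%N :> nat).
have E (c : 'I_d) : #|[set x | (idx x <= c)%N]| =
    (\sum_(i : 'I_d | i <= c) (alpha i).+1)%N.
  rewrite (card_prefix sv idxv idxl idxs (fun i : 'I_d => i <= c)%N).
  by apply: eq_bigr => i _; rewrite av.
have [vA|vA] := boolP (v i0 \in A).
  have [c ->] := prefix _ ccA ccA' A1 A'1 vA.
  by exists c; left; rewrite E.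
rewrite -in_setC in vA; rewrite -(setCK A) in ccA A1.
have [c ->] := prefix _ ccA' ccA A'1 A1 vA.
by exists c; right; rewrite E.
Qed.

(** * Distances and cuts *)

Lemma sum_diag_upper (R : nmodType) d (F : 'I_d -> 'I_d -> R) :
  \sum_i \sum_j F i j =
  \sum_i F i i + \sum_(i < d) \sum_(j < d | (i < j)%N) (F i j + F j i).
Proof.
transitivity (\sum_(i < d) (F i i +
    (\sum_(j < d | (i < j)%N) F i j + \sum_(j < d | (j < i)%N) F i j))).
  apply: eq_bigr => i _; rewrite (bigD1 i) //=; congr (_ + _).
  rewrite (bigID (fun j : 'I_d => i < j)%N) /=.
  by congr (_ + _); apply: eq_bigl => j; rewrite -(inj_eq val_inj) /=; case: ltngtP.
rewrite big_split; congr (_ + _).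
under [RHS]eq_bigr do rewrite big_split.
rewrite !big_split; congr (_ + _).
by rewrite (exchange_big_dep xpredT).
Qed.

Section Wiener.
Variables (d : nat) (a : 'I_d -> rat).

Lemma sum_sq :
  (\sum_i a i) ^+ 2 =
  \sum_i a i ^+ 2 + 2 * \sum_(i < d) \sum_(j < d | (i < j)%N) a i * a j.
Proof.
rewrite expr2 big_distrlr /= sum_diag_upper; congr (_ + _).
rewrite mulr_sumr; apply: eq_bigr => i _; rewrite mulr_sumr.
by apply: eq_bigr => j _; ring.
Qed.

Lemma sum_dist :
  \sum_(i < d) a i * (\sum_(j < d | j != i) `|j%:R - i%:R|) =
  \sum_(i < d) \sum_(j < d | (i < j)%N) (a i + a j) * (j%:R - i%:R).
Proof.
transitivity (\sum_(i < d) \sum_(j < d) a i * `|j%:R - i%:R|).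
  apply: eq_bigr => i _; rewrite mulr_sumr [RHS](bigD1 i) //=.
  by rewrite subrr normr0 mulr0 add0r.
rewrite sum_diag_upper big1 ?add0r => [|i _]; last first.
  by rewrite subrr normr0 mulr0.
apply: eq_bigr => i _; apply: eq_bigr => j ij.
rewrite (distrC i%:R) ger0_norm -?mulrDl //.
by rewrite subr_ge0 ler_nat ltnW.
Qed.

(** Both sides count, with weight a i * a j, the cuts c with i <= c < j: there
are j - i of them. *)
Lemma sum_cuts :
  \sum_(c : 'I_d) (\sum_(i : 'I_d | (i <= c)%N) a i) *
     (\sum_i a i - \sum_(i : 'I_d | (i <= c)%N) a i) =
  \sum_(i < d) \sum_(j < d | (i < j)%N) a i * a j * (j%:R - i%:R).
Proof.
transitivity (\sum_(c : 'I_d) \sum_(i < d) \sum_(j < d)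
    if (i <= c < j)%N then a i * a j else 0).
  apply: eq_bigr => c _.
  rewrite [X in X - _](bigID (fun i : 'I_d => i <= c)%N) /=.
  rewrite [X in _ * X]addrAC subrr add0r.
  rewrite big_distrlr /= big_mkcond; apply: eq_bigr => i _.
  case: leqP => _ /=; last by rewrite big1.
  by rewrite big_mkcond; apply: eq_bigr => j _; rewrite ltnNge.
rewrite exchange_big; apply: eq_bigr => i _.
rewrite exchange_big [RHS]big_mkcond; apply: eq_bigr => j _ /=.
rewrite -big_mkcond sumr_const.
have -> : #|[pred c : 'I_d | i <= c < j]%N| = (j - i)%N.
  rewrite -sum1_card -[RHS]muln1 -sum_nat_const_nat (big_nat_widen _ _ d) 1?ltnW //.
  by rewrite big_geq_mkord; apply: eq_bigl => c; rewrite andbC.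
case: ltnP => [ij|ji]; first by rewrite -natrB ?(ltnW ij) // mulr_natr.
by move: ji; rewrite -subn_eq0 => /eqP ->; rewrite mulr0n.
Qed.
End Wiener.

Lemma natr_bin2 (m : nat) : 'C(m, 2)%:R = (m%:R ^+ 2 - m%:R) / 2%:R :> rat.
Proof.
have /(congr1 (fun i => i%:R : rat)) : ('C(m, 2) * 2 = m * m.-1)%N.
  by have := bin_ffact m 2; rewrite !ffactnS ffactn0 muln1.
rewrite !natrM; case: m => [|m] /=; first by rewrite bin0n expr0n subrr mul0r.
rewrite -(natr1 m) => E; apply: (mulIf (_ : 2%:R != 0 :> rat)).
  by rewrite pnatr_eq0.
by rewrite E; field.
Qed.

(** Put w = alpha + 1 and expand w i * w j * (j - i) in [sum_cuts].  What
remains is binomial(a, 2) - binomial(d, 2), through the squares of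
a = sum of the alpha i and of d = sum of 1. *)
Lemma wiener_cuts d (alpha : 'I_d -> nat) :
  let a := (\sum_(i < d) alpha i)%N in
  let n := (a + d)%N in
  let s (c : 'I_d) := (\sum_(i < d | (i <= c)%N) (alpha i).+1)%N in
  \sum_(i < d) 'C(alpha i, 2)%:R
    + \sum_(i < d) (alpha i)%:R * (\sum_(j < d | j != i) `|j%:R - i%:R|)
    + \sum_(i < d) \sum_(j < d | (i < j)%N)
        ((alpha i)%:R * (alpha j)%:R * (j%:R - i%:R + 1) + (j%:R - i%:R - 1))
  = \sum_(c < d) (s c)%:R * (n%:R - (s c)%:R)
    + (a%:R - d%:R) * (a%:R + d%:R - 1) / 2%:R :> rat.
Proof.
move=> a n s; pose w (i : 'I_d) : rat := (alpha i)%:R + 1.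
have sw c : (s c)%:R = \sum_(i < d | (i <= c)%N) w i.
  by rewrite natr_sum; apply: eq_bigr => i _; rewrite -natr1.
have nw : n%:R = \sum_i w i.
  by rewrite big_split /= sumr_const card_ord natrD natr_sum.
under [X in _ = X + _]eq_bigr do rewrite sw nw.
rewrite sum_cuts sum_dist.
have binE : \sum_(i < d) 'C(alpha i, 2)%:R =
    (\sum_(i < d) (alpha i)%:R ^+ 2 - a%:R) / 2%:R :> rat.
  rewrite natr_sum -sumrB mulr_suml; apply: eq_bigr => i _; exact: natr_bin2.
have aE := sum_sq (fun i => (alpha i)%:R).
have dE := sum_sq (fun i : 'I_d => 1).
rewrite -natr_sum -/a in aE; rewrite expr1n !sumr_const card_ord mulr1 in dE.
pose U := \sum_(i < d) \sum_(j < d | (i < j)%N) (alpha i)%:R * (alpha j)%:R : rat.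
pose D := \sum_(i < d) \sum_(j < d | (i < j)%N) 1 : rat.
rewrite -/U in aE; rewrite -/D in dE.
suff E : \sum_(i < d) \sum_(j < d | (i < j)%N)
      ((alpha i)%:R + (alpha j)%:R) * (j%:R - i%:R)
  + \sum_(i < d) \sum_(j < d | (i < j)%N)
        ((alpha i)%:R * (alpha j)%:R * (j%:R - i%:R + 1) + (j%:R - i%:R - 1))
  = \sum_(i < d) \sum_(j < d | (i < j)%N) w i * w j * (j%:R - i%:R) + U - D.
  rewrite -addrA E binE; lra.
rewrite -!big_split -sumrB; apply: eq_bigr => i _.
rewrite -!big_split -sumrB; apply: eq_bigr => j _.
by rewrite /w /=; ring.
Qed.

(** * The inequality *)

Theorem theorem3p5 (G : sgraph) (d : nat) (alpha : 'I_d -> nat)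
    (hC : caterpillar G alpha) (hpos : e_positive G) :
  let a := (\sum_(i < d) alpha i)%N in
  let n := (a + d)%N in
  \sum_(uphalf n <= k < n.-1) k%:R * (n%:R - k%:R)
    + (a%:R - d%:R) * (a%:R + d%:R - 1) / 2%:R
  <= \sum_(i < d) 'C(alpha i, 2)%:R
    + \sum_(i < d) (alpha i)%:R * (\sum_(j < d | j != i) `|j%:R - i%:R|)
    + \sum_(i < d) \sum_(j < d | (i < j)%N)
        ((alpha i)%:R * (alpha j)%:R * (j%:R - i%:R + 1) + (j%:R - i%:R - 1))
  :> rat.
Proof.
cbv zeta; pose a := (\sum_(i < d) alpha i)%N; pose n := (a + d)%N.
rewrite wiener_cuts lerD2r -/a -/n.
set s := fun c : 'I_d => (\sum_(i < d | (i <= c)%N) (alpha i).+1)%N.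
have Gn : #|G| = n.
  rewrite (caterpillar_card hC); under eq_bigr do rewrite -addn1.
  by rewrite big_split sum1_card card_ord.
have s_le c : (s c <= n)%N.
  rewrite -Gn (caterpillar_card hC).
  by rewrite [leqRHS](bigID (fun i : 'I_d => i <= c)%N) leq_addr.
pose g k : rat := k%:R * (n%:R - k%:R).
pose m c := maxn (s c) (n - s c).
have gm c : g (s c) = g (m c).
  rewrite /m; case: leqP => // _; rewrite /g natrB //; ring.
have g0 k : (k <= n)%N -> 0 <= g k.
  by move=> kn; rewrite mulr_ge0 ?ler0n // subr_ge0 ler_nat.
(* The bounds on k give 2 <= n - k <= k, so both sides of the cut have at least
   two vertices. *)
have hit k : (uphalf n <= k < n.-1)%N -> exists c, m c == k.
  move=> /andP[nk kn].
  have [tG _] := hC.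
  have lk : (0 < n - k <= k)%N by lia.
  have [A [Al cA cA']] : exists A : {set G},
    [/\ #|A| = n - k, cut_connected A & cut_connected (~: A)]%N.
    by apply: e_positive_cut tG hpos lk _; rewrite Gn; lia.
  have A'k : #|~: A| = k by have := cardsC A; lia.
  have [||c sc] := caterpillar_cut hC cA cA'; [lia|lia|].
  by exists c; rewrite /m; case: sc; rewrite -/(s c) ?A'k ?Al => ->; lia.
(* Each term g k on the left is charged to a cut c with m c = k; every cut is
   charged by at most one k. *)
under [X in _ <= X]eq_bigr => c _ do rewrite -/(g (s c)) gm.
apply: (@le_trans _ _ (\sum_(uphalf n <= k < n.-1) \sum_(c | m c == k) g (m c))).
  rewrite big_nat_cond [X in _ <= X]big_nat_cond; apply: ler_sum => k /andP[kn _].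
  have [c ck] := hit k kn.
  rewrite (bigD1 c) //= (eqP ck) lerDl sumr_ge0 // => c' _.
  by rewrite g0 // /m geq_max s_le leq_subr.
rewrite (exchange_big_dep xpredT) //=; apply: ler_sum => c _.
under eq_bigl do rewrite eq_sym.
rewrite big_const_seq count_uniq_mem ?iota_uniq //.
by case: (_ \in _); rewrite /= ?addr0 // g0 // /m geq_max s_le leq_subr.
Qed.
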